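(* Let $r > t \ge 1$ be integers. There exists $n_{0}(r,t)$ such that every $(K_{r},t)$-intersecting graph $G$ on $n \ge n_{0}(r,t)$ vertices satisfies $$N(K_{r},G) \le N\left(K_r, S(n,r,t)\right),$$ and equality holds if and only if $G \cong S(n,r,t)$.
   Context: All graphs are finite and simple. $N(K_r,G)$ denotes the number of copies of $K_r$ in $G$, i.e. the number of $r$-subsets $S$ of $V(G)$ such that the induced subgraph $G[S]$ is isomorphic to the complete graph $K_r$. A graph $G$ is $(K_r,t)$-intersecting if for every two distinct $r$-sets $S,S'\subset V(G)$ with $G[S]\cong G[S']\cong K_r$ one has $|S\cap S'|\in\{t,t+1,\ldots,r-1\}$. $T(n,\ell)$ denotes the Turán graph, i.e. the balanced complete $\ell$-partite graph on $n$ vertices (part sizes differ by at most one). For integers $n \ge r > t \ge 0$, $S(n,r,t)$ denotes the graph obtained from the vertex-disjoint union of $K_t$ and $T(n-t,r-t)$ by adding all edges between the vertices of $K_t$ and the vertices of $T(n-t,r-t)$. *)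

(* Defs.v *)
From mathcomp Require Import all_boot.

Set Implicit Arguments.
Unset Strict Implicit.
Unset Printing Implicit Defensive.

Record sgraph := SGraph {
  vertex :> finType;
  adj : rel vertex;
  adj_sym : symmetric adj;
  adj_irr : irreflexive adj }.

(* Boolean, so that copies of K_r can be collected in a finite set;
   [graph_isoP] gives the usual Prop form. *)
Definition graph_iso (G H : sgraph) : bool :=
  [exists f : {ffun G -> H},
     [&& injectiveb f, [forall y, exists x, f x == y]
       & [forall x, forall y, adj (f x) (f y) == adj x y]]].

Lemma graph_isoP (G H : sgraph) :
  reflect (exists2 f : G -> H, bijective f &
             forall x y, adj (f x) (f y) = adj x y)
          (graph_iso G H).
Proof.
apply: (iffP existsP) => [[f /and3P[/injectiveP injf /forallP surjf /forallP fE]] | [f bijf fE]].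
  exists f => [|x y]; last by apply/eqP; move/forallP: (fE x).
  have surj y : exists x, f x == y by apply/existsP.
  exists (fun y => xchoose (surj y)) => [x|y]; last exact/eqP/(xchooseP (surj y)).
  exact/injf/eqP/(xchooseP (surj (f x))).
exists (finfun f); apply/and3P; split.
- by apply/injectiveP => x y; rewrite !ffunE; apply: bij_inj.
- case: bijf => g _ gK; apply/forallP => y; apply/existsP; exists (g y).
  by rewrite ffunE gK.
- by apply/forallP => x; apply/forallP => y; rewrite !ffunE fE.
Qed.

Section Induced.
Variables (G : sgraph) (S : {set G}).

Definition induced_adj : rel {x : G | x \in S} :=
  fun u v => adj (val u) (val v).

Lemma induced_sym : symmetric induced_adj.
Proof. by move=> u v; apply: adj_sym. Qed.

Lemma induced_irr : irreflexive induced_adj.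
Proof. by move=> u; apply: adj_irr. Qed.

Definition induced := SGraph induced_sym induced_irr.
End Induced.

Section Complete.
Variable m : nat.

Definition complete_adj : rel 'I_m := fun i j => i != j.

Lemma complete_sym : symmetric complete_adj.
Proof. by move=> i j; rewrite /complete_adj eq_sym. Qed.

Lemma complete_irr : irreflexive complete_adj.
Proof. by move=> i; rewrite /complete_adj eqxx. Qed.

Definition complete := SGraph complete_sym complete_irr.
End Complete.

(* The parts are the residue classes mod l, whose sizes in {0, ..., m-1} differ
   by at most one. Only meaningful for 0 < l: in MathComp i %% 0 = i. *)
Section Turan.
Variables m l : nat.

Definition turan_adj : rel 'I_m := fun i j => i %% l != j %% l.

Lemma turan_sym : symmetric turan_adj.
Proof. by move=> i j; rewrite /turan_adj eq_sym. Qed.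

Lemma turan_irr : irreflexive turan_adj.
Proof. by move=> i; rewrite /turan_adj eqxx. Qed.

Definition turan := SGraph turan_sym turan_irr.
End Turan.

Section Join.
Variables G H : sgraph.

Definition join_adj : rel (G + H)%type := fun u v =>
  match u, v with
  | inl x, inl y => adj x y
  | inr x, inr y => adj x y
  | _, _ => true
  end.

Lemma join_sym : symmetric join_adj.
Proof. by move=> [x|x] [y|y] //=; apply: adj_sym. Qed.

Lemma join_irr : irreflexive join_adj.
Proof. by move=> [x|x] /=; apply: adj_irr. Qed.

Definition join := SGraph join_sym join_irr.
End Join.

(* Meant for t < r <= n, where the subtractions are not truncated. *)
Definition Sgraph (n r t : nat) : sgraph :=
  join (complete t) (turan (n - t) (r - t)).

Definition is_copy (r : nat) (G : sgraph) (S : {set G}) : bool :=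
  (#|S| == r) && graph_iso (induced S) (complete r).

Definition Ncopies (r : nat) (G : sgraph) : nat :=
  #|[set S : {set G} | is_copy r S]|.

Definition intersecting (r t : nat) (G : sgraph) : Prop :=
  forall S S' : {set G}, is_copy r S -> is_copy r S' -> S != S' ->
    t <= #|S :&: S'| < r.

(* Main.v *)
Require Import Defs.
From mathcomp Require Import all_boot zify.

(* If the r-cliques have no common t-subset, fix one of them, S1. Any r-clique S
   contains a t-subset U of S1; some r-clique W does not contain U, and since
   |S :&: W| >= t, S contains a vertex of W outside U. So S contains one of
   boundedly many (t+1)-sets, and there are only O(n^(r-t-1)) r-cliques.
   Otherwise all r-cliques contain a t-clique U, whose common neighbourhood N is
   K_(r-t+1)-free because t >= 1. The r-cliques then correspond to (r-t)-cliques
   of N, which Zykov's theorem counts: a vertex v in the most s-cliques of a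
   K_(s+1)-free graph has a K_s-free neighbourhood, so every s-clique contains a
   non-neighbour of v, each lying in at most as many s-cliques as v, and one
   applies induction to the neighbourhood of v. *)

Set Implicit Arguments.
Unset Strict Implicit.
Unset Printing Implicit Defensive.

(** * Bijections between sets with equal fibre sizes *)

Definition fiber_rank (X : finType) (J : eqType) (c : X -> J) (x : X) :=
  index x (enum [set y | c y == c x]).

Lemma fiber_rank_inj (X : finType) (J : eqType) (c : X -> J) (x y : X) :
  c x = c y -> fiber_rank c x = fiber_rank c y -> x = y.
Proof.
move=> cxy; rewrite /fiber_rank cxy; apply: index_inj => //.
  by rewrite mem_enum inE cxy.
by rewrite mem_enum inE.
Qed.

Lemma fiber_rank_ex (X Y : finType) (J : eqType) (c : X -> J) (d : Y -> J) :
  (forall j, #|[set x | c x == j]| = #|[set y | d y == j]|) ->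
  forall x, exists y, (d y == c x) && (fiber_rank d y == fiber_rank c x).
Proof.
move=> cd x; set s := enum [set y | d y == c x].
have lt_x : fiber_rank c x < size s.
  by rewrite -cardE -cd cardE index_mem mem_enum inE.
have [y0 _] : exists y0, y0 \in s.
  by case: s lt_x => // y0 s' _; exists y0; rewrite mem_head.
have: nth y0 s (fiber_rank c x) \in s by rewrite mem_nth.
rewrite mem_enum inE => dy; exists (nth y0 s (fiber_rank c x)).
by rewrite dy /= {1}/fiber_rank (eqP dy) index_uniq ?enum_uniq.
Qed.

(** The point of rank k in a fibre of [c] is matched with the point of rank k in the same fibre of
    [d]; exchanging [c] and [d] gives the inverse. *)
Lemma fiber_bij (X Y : finType) (J : eqType) (c : X -> J) (d : Y -> J) :
  (forall j, #|[set x | c x == j]| = #|[set y | d y == j]|) ->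
  exists2 f : X -> Y, bijective f & forall x, d (f x) = c x.
Proof.
move=> cd.
have exf := fiber_rank_ex cd.
have exg := fiber_rank_ex (fun j => esym (cd j)).
exists (fun x => xchoose (exf x)); last by move=> x; case/andP: (xchooseP (exf x)) => /eqP.
exists (fun y => xchoose (exg y)) => [x|y].
  case/andP: (xchooseP (exg (xchoose (exf x)))) => /eqP e1 /eqP e2.
  case/andP: (xchooseP (exf x)) => /eqP e3 /eqP e4.
  by apply: (@fiber_rank_inj _ _ c); [rewrite e1|rewrite e2].
case/andP: (xchooseP (exf (xchoose (exg y)))) => /eqP e1 /eqP e2.
case/andP: (xchooseP (exg y)) => /eqP e3 /eqP e4.
by apply: (@fiber_rank_inj _ _ d); [rewrite e1|rewrite e2].
Qed.

(** * Balanced families and the product of part sizes *)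

Definition balanced (I : finType) (a : I -> nat) := forall i j, a i <= (a j).+1.

Lemma balancedP (I : finType) (a : I -> nat) :
  reflect (balanced a) [forall i, forall j, a i <= (a j).+1].
Proof.
by apply: (iffP forallP) => bal i; [move=> j; apply: (forallP (bal i)) | apply/forallP].
Qed.

(** Only the minimum q and q + 1 occur as values. If q + 1 occurs on [E], the sum is |I| q + |E|
    with |E| < |I|, so q and |E| are the quotient and remainder of the sum by |I|. *)
Lemma balanced_fiber (I : finType) (a : I -> nat) (v : nat) :
  0 < #|I| -> balanced a ->
  let m := \sum_i a i in
  #|[set i | a i == v]| =
  if v == (m %/ #|I|).+1 then m %% #|I|
  else if v == m %/ #|I| then #|I| - m %% #|I| else 0.
Proof.
move=> I0 bal m; have [i0 _] := card_gt0P I0.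
pose j := [arg min_(i < i0) a i]; set q := a j.
have qle i : q <= a i by rewrite /q /j; case: arg_minnP => // k _; apply.
pose E := [set i | a i == q.+1].
have aE i : a i = q + (i \in E).
  by rewrite inE; move: (qle i) (bal i j); rewrite -/q; case: eqP; lia.
have mE : m = #|I| * q + #|E|.
  rewrite /m (eq_bigr (fun i => q + (i \in E))) => [|i _]; last exact: aE.
  rewrite big_split /= sum_nat_const; congr (_ + _).
  by rewrite -sum1_card [RHS]big_mkcond; apply: eq_bigr => i _; case: (i \in E).
have ltE : #|E| < #|I|.
  rewrite -cardsT proper_card //; apply/properP; split; first exact: subsetT.
  by exists j; rewrite ?inE // -/q; lia.
have qE : m %/ #|I| = q by rewrite mE mulnC divnMDl // divn_small // addn0.
have rE : m %% #|I| = #|E| by rewrite mE mulnC modnMDl modn_small.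
rewrite qE rE; case: (v =P q.+1) => [->//|vq1].
case: (v =P q) => [->|vq].
  rewrite -[in RHS](setCK E) -cardsCs; congr #|pred_of_set _|; apply/setP=> i; rewrite !inE.
  by move: (aE i); rewrite inE; case: eqP; lia.
apply/eqP; rewrite cards_eq0; apply/eqP/setP=> i; rewrite !inE.
by move: (aE i); case: (i \in E); lia.
Qed.

Lemma balanced_bij (I : finType) (a b : I -> nat) :
  balanced a -> balanced b -> \sum_i a i = \sum_i b i ->
  exists2 f : I -> I, bijective f & forall i, b (f i) = a i.
Proof.
move=> bala balb ab; have [I0|I0] := posnP #|I|.
  by exists id => [|i]; [exists id | case: (card0_eq I0 i)].
by apply: fiber_bij => v; rewrite !balanced_fiber // ab.
Qed.

(** Move one unit from a part x to a part y with y + 1 < x: then (x - 1)(y + 1) > x y, and the other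
    factors are positive. *)
Lemma bump_prod (I : finType) (a : I -> nat) :
  0 < \prod_i a i -> ~ balanced a ->
  exists2 b : I -> nat, \sum_i b i = \sum_i a i & \prod_i a i < \prod_i b i.
Proof.
move=> a0 nbal.
have [i [j lt_ji]] : exists i j, (a j).+1 < a i.
  have /existsP[i /existsP[j ij]] : [exists i, exists j, (a j).+1 < a i].
    apply: contra_notT nbal; rewrite negb_exists => /forallP H i j.
    by move: (H i); rewrite negb_exists => /forallP/(_ j); rewrite -leqNgt.
  by exists i, j.
have ij : i != j by apply/eqP=> e; move: lt_ji; rewrite e; lia.
exists (fun k => if k == i then (a i).-1 else if k == j then (a j).+1 else a k).
  rewrite (bigD1 i) // (bigD1 j) /=; last by rewrite eq_sym.
  rewrite [RHS](bigD1 i) //= [in RHS](bigD1 j) /=; last by rewrite eq_sym.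
  rewrite !eqxx eq_sym (negPf ij) !addnA.
  congr (_ + _); first lia.
  by apply: eq_bigr => k /andP[/negPf-> /negPf->].
move: a0.
rewrite (bigD1 i) // (bigD1 j) /=; last by rewrite eq_sym.
rewrite [X in _ -> _ < X](bigD1 i) //= [in X in _ -> _ < X](bigD1 j) /=; last by rewrite eq_sym.
rewrite !eqxx eq_sym (negPf ij) !mulnA.
rewrite [X in _ -> _ < _ * X](eq_bigr a) => [|k /andP[/negPf-> /negPf->] //].
rewrite !muln_gt0 -!andbA => /and3P[ai aj p].
rewrite ltn_pmul2r //; nia.
Qed.

Lemma prod_le_balanced (I : finType) (a b : I -> nat) :
  balanced b -> \sum_i a i = \sum_i b i -> \prod_i a i <= \prod_i b i.
Proof.
move=> balb.
have bound (c : I -> nat) : \sum_i c i = \sum_i b i -> \prod_i c i <= (\sum_i b i) ^ #|I|.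
  move=> cb; rewrite -prod_nat_const leq_prod // => i _.
  by rewrite -cb (bigD1 i) //= leq_addr.
(* Each bump raises the product, which stays below the crude bound; the induction is on the
   remaining gap. It ends at a balanced family, a permutation of [b]. *)
have [k] := ubnP ((\sum_i b i) ^ #|I| - \prod_i a i).
elim: k a => // k IH a lek ab.
have [->//|a0] := posnP (\prod_i a i).
have [/balancedP bala|/balancedP nbal] := boolP [forall i, forall j, a i <= (a j).+1].
  have [f bijf fE] := balanced_bij bala balb ab.
  by rewrite [leqRHS](reindex f) /=; [under [leqRHS]eq_bigr do rewrite fE | apply: onW_bij].
have [a' a'a lt_a] := bump_prod a0 nbal.
apply: leq_trans (ltnW lt_a) _; apply: IH; last by rewrite a'a.
by have := bound a'; rewrite a'a => /(_ ab); lia.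
Qed.

(** * Part sizes and clique count of the Turan graph *)

Definition turan_part (m s : nat) (i : 'I_s) := m %/ s + (i < m %% s).

(** The number of K_s in T(m, s), one vertex being chosen from each part; it is 1 for s = 0. *)
Definition turan_count (m s : nat) := \prod_(i < s) turan_part m i.

Lemma turan_part_balanced m s : balanced (@turan_part m s).
Proof. by move=> i j; rewrite /turan_part; lia. Qed.

Lemma sum_turan_part m s : 0 < s -> \sum_(i < s) turan_part m i = m.
Proof.
move=> s0; rewrite big_split /= sum_nat_const card_ord mulnC.
rewrite [RHS](divn_eq m s); congr (_ + _).
have sum_lt k n : \sum_(i < n) (i < k) = minn k n.
  by elim: n => [|n IH]; rewrite ?big_ord0 ?big_ord_recr /= ?IH; lia.
by rewrite sum_lt; apply/minn_idPl/ltnW/ltn_pmod.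
Qed.

Lemma incr_prod (I : finType) (a : I -> nat) m :
  0 < \prod_i a i -> 0 < #|I| -> \sum_i a i < m ->
  exists2 b : I -> nat, \sum_i b i = m & \prod_i a i < \prod_i b i.
Proof.
move=> a0 /card_gt0P[j _] am.
exists (fun i => if i == j then a j + (m - \sum_i a i) else a i).
  rewrite [LHS](bigD1 j) //= eqxx.
  rewrite [X in _ + X](eq_bigr a) => [|i /negPf-> //].
  by move: am; rewrite (bigD1 j) //=; lia.
move: a0; rewrite (bigD1 j) //= [X in _ -> _ < X](bigD1 j) //= eqxx.
rewrite [X in _ -> _ < _ * X](eq_bigr a) => [|i /negPf-> //].
by rewrite muln_gt0 => /andP[? ?]; rewrite ltn_pmul2r //; lia.
Qed.

Lemma prod_le_turan_count m s (a : 'I_s -> nat) :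
  0 < s -> \sum_i a i <= m -> \prod_i a i <= turan_count m s.
Proof.
move=> s0; rewrite leq_eqVlt => /orP[/eqP am|am].
  by apply: prod_le_balanced; [apply: turan_part_balanced | rewrite sum_turan_part].
have [->//|a0] := posnP (\prod_i a i).
have [|b bm /ltnW le_ab] := incr_prod a0 _ am; first by rewrite card_ord.
apply: leq_trans le_ab _.
by apply: prod_le_balanced; [apply: turan_part_balanced | rewrite sum_turan_part].
Qed.

(** A deficit in the sum or an unbalanced pair would allow a larger product, by [incr_prod] or
    [bump_prod]; positivity makes the gain strict. *)
Lemma prod_eq_turan_count m s (a : 'I_s -> nat) :
  0 < s -> \sum_i a i <= m -> \prod_i a i = turan_count m s ->
  0 < turan_count m s -> \sum_i a i = m /\ balanced a.
Proof.
move=> s0 am aE; rewrite -aE => a0.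
have max (b : 'I_s -> nat) : \sum_i b i = m -> ~~ (\prod_i a i < \prod_i b i).
  by move=> bm; rewrite aE -leqNgt prod_le_turan_count // bm.
have {}am : \sum_i a i = m.
  apply/eqP; move: am; rewrite leq_eqVlt => /orP[//|am].
  have [|b bm] := incr_prod a0 _ am; first by rewrite card_ord.
  by rewrite (negPf (max b bm)).
split=> //; apply/balancedP; apply/negPn/negP => /balancedP nbal.
have [b bm] := bump_prod a0 nbal.
by rewrite (negPf (max b _)) // bm.
Qed.

(** A part of size [m - d] placed beside the parts of T(d, s) gives [s.+1] parts. *)
Lemma turan_countS m d s :
  d <= m -> (m - d) * turan_count d s <= turan_count m s.+1.
Proof.
move=> dm; pose a (i : 'I_s.+1) := oapp (@turan_part d s) (m - d) (unlift ord0 i).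
have -> : (m - d) * turan_count d s = \prod_i a i.
  rewrite big_ord_recl /a unlift_none /=; congr (_ * _).
  by apply: eq_bigr => i _; rewrite liftK.
apply: prod_le_turan_count => //.
rewrite big_ord_recl /a unlift_none /=; under eq_bigr do rewrite liftK /=.
(* For s = 0 the parts total only [m - d], so just an inequality with [m] is available. *)
by case: s a => [|s] a; rewrite ?big_ord0 ?sum_turan_part //; lia.
Qed.

Lemma card_residue_class m s (i : 'I_s) :
  #|[set j : 'I_m | j %% s == i]| = turan_part m i.
Proof.
have s0 : 0 < s by apply: leq_ltn_trans (ltn_ord i).
rewrite -sum1_card big_mkcond.
under eq_bigr do rewrite inE.
rewrite /turan_part; elim: m => [|m IH]; first by rewrite big_ord0 div0n mod0n.
rewrite big_ord_recr /= IH {IH}; have := ltn_pmod m s0; have := ltn_ord i.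
have -> : m.+1 = m %/ s * s + (m %% s).+1 by rewrite addnS -divn_eq.
(* Either the remainder of [m] is s - 1 and wraps to 0, raising the quotient, or it grows by one. *)
rewrite divnMDl // modnMDl => lt_is; rewrite leq_eqVlt => /orP[/eqP e|lt].
  by rewrite e divnn modnn s0; case: eqP; lia.
by rewrite (divn_small lt) (modn_small lt); case: eqP; lia.
Qed.

(** * Cliques and their number in complete multipartite sets *)

Section Cliques.
Variable G : sgraph.
Implicit Types (A N Q S : {set G}) (x y v : G).

Definition clique S := [forall x in S, forall y in S, (x != y) ==> adj x y].

Lemma cliqueP S :
  reflect {in S &, forall x y, x != y -> adj x y} (clique S).
Proof.
apply: (iffP forall_inP) => [cS x y xS yS | cS x xS].
  by move/implyP: (forall_inP (cS x xS) y yS).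
by apply/forall_inP => y yS; apply/implyP; apply: cS.
Qed.

Lemma clique_sub S Q : S \subset Q -> clique Q -> clique S.
Proof.
move=> /subsetP sSQ /cliqueP cQ; apply/cliqueP => x y xS yS.
by apply: cQ; apply: sSQ.
Qed.

Lemma cliqueU S Q : clique S -> clique Q ->
  {in S & Q, forall x y, x != y -> adj x y} -> clique (S :|: Q).
Proof.
move=> /cliqueP cS /cliqueP cQ cSQ; apply/cliqueP => x y.
rewrite !inE => /orP[xS|xQ] /orP[yS|yQ] xy; try by [apply: cS|apply: cQ|apply: cSQ].
by rewrite adj_sym; apply: cSQ; rewrite // eq_sym.
Qed.

Lemma clique1 x : clique [set x].
Proof. by apply/cliqueP => y z /set1P-> /set1P->; rewrite eqxx. Qed.

(** Every bijection from an r-clique to ['I_r] is an isomorphism, so enumeration ranks provide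
    one. *)
Lemma is_copyE r S : is_copy r S = (#|S| == r) && clique S.
Proof.
apply/andP/andP => [] [/eqP cS cl]; split; rewrite ?cS //.
  case/graph_isoP: cl => f /bij_inj injf fE; apply/cliqueP => x y xS yS xy.
  have := fE (exist _ x xS) (exist _ y yS); rewrite /= /induced_adj /= => <-.
  by rewrite /complete_adj inj_eq.
have e : #|{: {x | x \in S}}| = r by rewrite card_sig -cS; apply: eq_card.
apply/graph_isoP; exists (fun u => cast_ord e (enum_rank u)).
  exists (fun i => enum_val (cast_ord (esym e) i)) => u.
    by rewrite cast_ordK enum_rankK.
  by rewrite enum_valK cast_ordKV.
move=> u v; rewrite /= /complete_adj /induced_adj.
rewrite (inj_eq (@cast_ord_inj _ _ _)) (inj_eq enum_rank_inj) -val_eqE.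
have [->|uv] := eqVneq; first by rewrite adj_irr.
by symmetry; apply: (cliqueP _ cl); rewrite ?(valP u) ?(valP v).
Qed.

Definition cliques s A := [set S : {set G} | [&& S \subset A, #|S| == s & clique S]].

Lemma cliquesP s A S :
  reflect [/\ S \subset A, #|S| = s & clique S] (S \in cliques s A).
Proof. by rewrite inE; apply: (iffP and3P) => [[? /eqP]|[? /eqP]]. Qed.

Lemma Ncopies_cliques r : Ncopies r G = #|cliques r [set: G]|.
Proof.
by apply: eq_card => S; rewrite !inE is_copyE subsetT.
Qed.

(** A clique of |I| vertices has pairwise distinct colours, hence one vertex of each. It is thus the
    image of a unique choice function in [family F], and these are counted by the product. *)
Lemma card_multipartite_cliques (I : finType) (c : G -> I) A :
  {in A &, forall x y, adj x y = (c x != c y)} ->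
  #|cliques #|I| A| = \prod_i #|[set x in A | c x == i]|.
Proof.
move=> cA; pose F i := [set x in A | c x == i].
have -> : \prod_i #|F i| = #|(family F : simpl_pred {ffun I -> G})|.
  by rewrite card_family foldrE big_map enumT.
pose im (f : {ffun I -> G}) := [set f i | i : I].
have FP (f : {ffun I -> G}) : f \in family F -> forall i, f i \in A /\ c (f i) = i.
  by move=> /familyP fF i; move: (fF i); rewrite inE => /andP[? /eqP].
have im_inj : {in family F &, injective im}.
  move=> f g /FP fF /FP gF fg; apply/ffunP => i.
  have: f i \in im g by rewrite -fg imset_f.
  case/imsetP => j _ e.
  by have := (fF i).2; rewrite e (gF j).2 => ->.
rewrite -(card_in_imset im_inj); apply: eq_card => S.
apply/cliquesP/imsetP => [[SA cS clS]|[f /FP fF ->]].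
  have c_inj : {in S &, injective c}.
    move=> x y xS yS cxy; apply/eqP/negPn/negP => xy.
    have := cliqueP _ clS x y xS yS xy.
    by rewrite cA ?(subsetP SA) // cxy eqxx.
  have cST i : exists x, (x \in S) && (c x == i).
    have: i \in c @: S.
      have/eqP-> : c @: S == setT by rewrite eqEcard subsetT cardsT card_in_imset // cS /=.
      by rewrite inE.
    by case/imsetP => x xS ->; exists x; rewrite xS eqxx.
  pose f := [ffun i => xchoose (cST i)].
  have fP i : f i \in S /\ c (f i) = i.
    by rewrite ffunE; case/andP: (xchooseP (cST i)) => ? /eqP.
  exists f.
    apply/familyP => i; rewrite inE; have [fS ->] := fP i.
    by rewrite (subsetP SA) ?eqxx.
  apply/eqP; rewrite eq_sym eqEcard; apply/andP; split.
    by apply/subsetP => x /imsetP[i _ ->]; case: (fP i).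
  rewrite cS card_imset // => i j e.
  by rewrite -(fP i).2 e (fP j).2.
split.
- by apply/subsetP => x /imsetP[i _ ->]; case: (fF i).
- by rewrite card_imset // => i j e; rewrite -(fF i).2 e (fF j).2.
apply/cliqueP => x y /imsetP[i _ ->] /imsetP[j _ ->] ij.
rewrite cA ?(fF i).1 ?(fF j).1 // (fF i).2 (fF j).2.
by apply: contraNneq ij => ->.
Qed.
End Cliques.

(** * Isomorphism through colourings, and invariance of the clique count *)

Lemma graph_iso_coloring (G H : sgraph) (I : finType) (c : G -> I) (d : H -> I) :
  (forall x y, adj x y = (c x != c y)) -> (forall x y, adj x y = (d x != d y)) ->
  (forall i, #|[set x | c x == i]| = #|[set y | d y == i]|) -> graph_iso G H.
Proof.
move=> cE dE /fiber_bij[f bijf fE]; apply/graph_isoP; exists f => // x y.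
by rewrite cE dE !fE.
Qed.

Lemma graph_iso_sym (G H : sgraph) : graph_iso G H -> graph_iso H G.
Proof.
case/graph_isoP => f [g fK gK] fE; apply/graph_isoP; exists g; first by exists f.
by move=> x y; rewrite -fE !gK.
Qed.

Lemma Ncopies_iso_le r (G H : sgraph) : graph_iso G H -> Ncopies r G <= Ncopies r H.
Proof.
case/graph_isoP => f /bij_inj injf fE; rewrite !Ncopies_cliques.
rewrite -(card_imset _ (imset_inj injf)); apply/subset_leq_card/subsetP => _ /imsetP[S + ->].
case/cliquesP => _ cS /cliqueP clS; apply/cliquesP; split; first exact: subsetT.
  by rewrite card_imset.
apply/cliqueP => _ _ /imsetP[x xS ->] /imsetP[y yS ->] xy.
by rewrite fE clS //; apply: contraNneq xy => ->.
Qed.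

Lemma Ncopies_iso r (G H : sgraph) : graph_iso G H -> Ncopies r G = Ncopies r H.
Proof.
move=> GH; apply/eqP.
by rewrite eqn_leq !Ncopies_iso_le ?(graph_iso_sym GH).
Qed.

(** * S(n, r, t) as a complete multipartite graph with t singleton parts *)

Definition Sgraph_color (n r t : nat) (rt : 0 < r - t) (x : Sgraph n r t) : 'I_t + 'I_(r - t) :=
  match x with
  | inl i => inl i
  | inr j => inr (Ordinal (ltn_pmod j rt))
  end.

Lemma Sgraph_colorE n r t rt (x y : Sgraph n r t) :
  adj x y = (Sgraph_color rt x != Sgraph_color rt y).
Proof. by case: x y => [x|x] [y|y]. Qed.

Lemma card_Sgraph_color n r t rt (i : 'I_t + 'I_(r - t)) :
  #|[set x : Sgraph n r t | Sgraph_color rt x == i]| =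
  if i is inr j then turan_part (n - t) j else 1.
Proof.
case: i => i.
  rewrite -(card1 (inl i : Sgraph n r t)); apply: eq_card => -[x|x]; by rewrite !inE.
rewrite -card_residue_class -(card_imset _ (@inr_inj 'I_t 'I_(n - t))).
apply: eq_card => -[x|x]; rewrite !inE.
  by symmetry; apply/imsetP => -[].
by rewrite mem_imset ?inE //; apply: inr_inj.
Qed.

Lemma Ncopies_Sgraph n r t :
  t < r -> Ncopies r (Sgraph n r t) = turan_count (n - t) (r - t).
Proof.
move=> tr; have rt : 0 < r - t by rewrite subn_gt0.
rewrite Ncopies_cliques.
have e : #|{: 'I_t + 'I_(r - t)}| = r by rewrite card_sum !card_ord; lia.
rewrite -[X in cliques X _]e.
rewrite (card_multipartite_cliques (c := Sgraph_color rt)) => [|x y _ _]; last first.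
  exact: Sgraph_colorE.
(* The singleton parts contribute factors 1. *)
rewrite big_sumType /= big1 ?mul1n => [|i _]; last first.
  by rewrite -[RHS](card_Sgraph_color n rt (inl i)); apply: eq_card => x; rewrite !inE.
apply: eq_bigr => i _.
by rewrite -(card_Sgraph_color n rt (inr i)); apply: eq_card => x; rewrite !inE.
Qed.

(** * Zykov's theorem with its equality case *)

Section Zykov.
Variable G : sgraph.
Implicit Types (A N Q S : {set G}) (u v w x y : G).

Definition nbrs v := [set w | adj v w].

Lemma nbrs_clique_extend s A v Q : v \in A ->
  Q \in cliques s (A :&: nbrs v) -> v |: Q \in cliques s.+1 A.
Proof.
move=> vA /cliquesP[/subsetIP[QA /subsetP Qv] cQ clQ]; apply/cliquesP; split.
- by rewrite subUset sub1set vA.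
- rewrite cardsU1 cQ; suff -> : v \notin Q by [].
  by apply/negP => /Qv; rewrite inE adj_irr.
apply: cliqueU => //; first exact: clique1.
by move=> x y /set1P-> /Qv; rewrite inE.
Qed.

Definition clique_deg s A v := #|[set S in cliques s A | v \in S]|.

(** Deleting [v] and adding it back are mutually inverse. *)
Lemma clique_degE s A v :
  v \in A -> clique_deg s.+1 A v = #|cliques s (A :&: nbrs v)|.
Proof.
move=> vA; have vN Q : Q \in cliques s (A :&: nbrs v) -> v \notin Q.
  case/cliquesP => /subsetP QA _ _; apply/negP => /QA.
  by rewrite !inE adj_irr andbF.
rewrite -(card_in_imset (f := fun Q => v |: Q)); last first.
  by move=> Q Q' /vN vQ /vN vQ' e; rewrite -(setU1K vQ) e setU1K.
apply: eq_card => S; rewrite inE; apply/andP/imsetP => [[CS vS]|[Q QN ->]]; last first.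
  by rewrite nbrs_clique_extend ?setU11.
exists (S :\ v); last by rewrite setD1K.
case/cliquesP: CS => SA cS clS; apply/cliquesP; split.
- apply/subsetP => x; rewrite !inE => /andP[xv xS].
  by rewrite (subsetP SA) //=; apply: (cliqueP _ clS); rewrite // eq_sym.
- by move: cS; rewrite (cardsD1 v) vS => -[].
by apply: clique_sub clS; apply: subD1set.
Qed.

Lemma clique_free_nbrs s A v : v \in A ->
  cliques s.+1 A = set0 -> cliques s (A :&: nbrs v) = set0.
Proof.
move=> vA A0; apply/setP => Q; rewrite in_set0; apply/negP.
by move/(nbrs_clique_extend vA); rewrite A0 in_set0.
Qed.

(** Double counting of the pairs of an s-clique and a vertex of [N] in it. *)
Lemma sum_clique_deg s A N :
  \sum_(u in N) clique_deg s A u = \sum_(S in cliques s A) #|S :&: N|.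
Proof.
have cardE (T : finType) (D E : {set T}) : #|D :&: E| = \sum_(x in D) (x \in E).
  rewrite -sum1_card -big_mkcondr /=.
  by apply: eq_bigl => x; rewrite inE.
rewrite (eq_bigr (fun u => \sum_(S in cliques s A) (u \in S))) => [|u _]; last first.
  by rewrite /clique_deg -sum1_card -big_mkcondr /=; apply: eq_bigl => S; rewrite !inE.
rewrite exchange_big /=; apply: eq_bigr => S _.
by rewrite setIC cardE.
Qed.

(* Erdos' argument: every (s+1)-clique of A meets B, since otherwise adding v to
   it would give an (s+2)-clique. *)
Lemma zykov_vertex s A v (B := A :\: nbrs v) :
  cliques s.+2 A = set0 -> v \in A ->
  {in A, forall u, clique_deg s.+1 A u <= clique_deg s.+1 A v} ->
  clique_deg s.+1 A v <= turan_count #|A :&: nbrs v| s ->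
  #|cliques s.+1 A| <= turan_count #|A| s.+1 /\
  (#|cliques s.+1 A| = turan_count #|A| s.+1 ->
   [/\ clique_deg s.+1 A v = turan_count #|A :&: nbrs v| s,
       {in B, forall u, clique_deg s.+1 A u = clique_deg s.+1 A v} &
       {in cliques s.+1 A, forall S, #|S :&: B| = 1}]).
Proof.
move=> A0 vA maxv; set N := A :&: nbrs v => degv.
have hit S : S \in cliques s.+1 A -> 0 < #|S :&: B|.
  move=> CS; rewrite lt0n; apply: contraTN isT => /eqP/cards0_eq SB.
  have: S \in cliques s.+1 N.
    case/cliquesP: CS => SA cS clS; apply/cliquesP; split=> //.
    apply/subsetP => x xS; have := in_set0 x; rewrite -SB !inE xS (subsetP SA) //=.
    by move/negbT; rewrite andbT negbK.
  by rewrite (clique_free_nbrs vA A0) in_set0.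
(* This starts a chain: the number of cliques is at most the sum of |S :&: B|, which is the sum of
   the degrees over [B], at most |B| times the degree of [v], and finally at most
   [turan_count #|A| s.+1]. Equality of the ends forces every link, and the [?= iff] conditions
   extract what this means. *)
have [le1 eq1] : #|cliques s.+1 A| <= \sum_(S in cliques s.+1 A) #|S :&: B|
    ?= iff [forall (S | S \in cliques s.+1 A), 1 == #|S :&: B|].
  by rewrite -sum1_card; apply: leqif_sum => S CS; split=> //; apply: hit.
have [le2 eq2] : \sum_(u in B) clique_deg s.+1 A u <= \sum_(u in B) clique_deg s.+1 A v
    ?= iff [forall (u | u \in B), clique_deg s.+1 A u == clique_deg s.+1 A v].
  by apply: leqif_sum => u uB; split=> //; apply: maxv; case/setDP: uB.
rewrite sum_nat_const in le2 eq2; rewrite -sum_clique_deg in le1 eq1.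
have cB : #|B| = #|A| - #|N| by rewrite -(cardsID (nbrs v) A) addKn.
have B0 : 0 < #|B| by apply/card_gt0P; exists v; rewrite !inE vA adj_irr.
have le3 := leq_mul (leqnn #|B|) degv.
have le4 : #|B| * turan_count #|N| s <= turan_count #|A| s.+1.
  by rewrite cB turan_countS // subset_leq_card // subsetIl.
split=> [|e]; first by do !apply: leq_trans le4; do !apply: leq_trans le3; lia.
split.
- by apply/eqP; rewrite -(eqn_pmul2l B0); lia.
- by move=> u uB; apply/eqP; move: u uB; apply/forall_inP; rewrite -eq2; lia.
- by move=> S CS; apply/esym/eqP; move: S CS; apply/forall_inP; rewrite -eq1; lia.
Qed.

(** In the equality case the non-neighbours [B] of a vertex [v] of maximal degree form one further
    part beside the neighbourhood [N]. That each vertex lies in an s-clique is carried through the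
    induction, because both the independence of [B] and its join to [N] rest on it. Positivity
    excludes |A| < s, where both counts vanish and no structure follows. *)
Lemma zykov s A : cliques s.+1 A = set0 ->
  #|cliques s A| <= turan_count #|A| s /\
  (#|cliques s A| = turan_count #|A| s -> 0 < #|cliques s A| ->
   (exists2 c : G -> nat, {in A, forall x, c x < s} &
      {in A &, forall x y, adj x y = (c x != c y)}) /\
   {in A, forall x, exists2 S, S \in cliques s A & x \in S}).
Proof.
elim: s A => [|s IH] A A0.
  have Ae : A = set0.
    apply/setP => x; rewrite in_set0; apply/negP => xA.
    suff: [set x] \in cliques 1 A by rewrite A0 in_set0.
    by apply/cliquesP; split; rewrite ?sub1set ?cards1 ?clique1.
  split=> [|_ _].
    rewrite /turan_count big_ord0 -(cards1 (set0 : {set G})).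
    by apply/subset_leq_card/subsetP => S /cliquesP[_ /cards0_eq-> _]; rewrite set11.
  by rewrite Ae; split; [exists (fun=> 0)|]; move=> x; rewrite in_set0.
have [Ae|[a aA]] := set_0Vmem A.
  have C0 : cliques s.+1 A = set0.
    apply/setP => S; rewrite in_set0; apply/negP => /cliquesP[].
    by rewrite Ae subset0 => /eqP->; rewrite cards0.
  by rewrite C0 cards0; split.
pose v := [arg max_(v > a in A) clique_deg s.+1 A v].
have [vA maxv] : v \in A /\ {in A, forall u, clique_deg s.+1 A u <= clique_deg s.+1 A v}.
  by rewrite /v; case: arg_maxnP => // w wA maxw; split=> // u /maxw.
have le_deg w : w \in A -> clique_deg s.+1 A w <= turan_count #|A :&: nbrs w| s.
  by move=> wA; rewrite clique_degE //; have [] := IH _ (clique_free_nbrs wA A0).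
have tight w wA maxw := zykov_vertex A0 wA maxw (le_deg w wA).
split=> [|eqA C0]; first by have [] := tight v vA maxv.
have [_ /(_ eqA)[degv degB hit1]] := tight v vA maxv.
set N := A :&: nbrs v in degv; set B := A :\: nbrs v in degB hit1.
have degv0 : 0 < clique_deg s.+1 A v.
  have [S CS] := card_gt0P C0.
  have /card_gt0P[u] : 0 < #|S :&: B| by rewrite hit1.
  rewrite inE => /andP[uS uB]; rewrite -(degB u uB).
  by apply/card_gt0P; exists S; rewrite inE CS.
(* Vertices of [B] share the maximal degree of [v], so each may replace [v], and the induction
   hypothesis applies to its own neighbourhood. *)
have colN w : w \in B ->
    (exists2 c : G -> nat, {in A :&: nbrs w, forall x, c x < s} &
       {in A :&: nbrs w &, forall x y, adj x y = (c x != c y)}) /\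
    {in A :&: nbrs w, forall x, exists2 S, S \in cliques s (A :&: nbrs w) & x \in S}.
  move=> wB; have wA : w \in A by case/setDP: wB.
  have maxw : {in A, forall u, clique_deg s.+1 A u <= clique_deg s.+1 A w}.
    by move=> u uA; rewrite (degB w wB) maxv.
  have [_ /(_ eqA)[degw _ _]] := tight w wA maxw.
  have [_] := IH _ (clique_free_nbrs wA A0).
  by rewrite -clique_degE // => /(_ degw); rewrite (degB w wB) => /(_ degv0).
have BA : B \subset A by apply: subsetDl.
(* For an edge [u w] inside [B], an s-clique through [w] in the neighbourhood of [u], extended by
   [u], would meet [B] twice. *)
have indepB : {in B &, forall u w, ~~ adj u w}.
  move=> u w uB wB; apply/negP => uw.
  have uA := subsetP BA u uB; have wA := subsetP BA w wB.
  have [_ /(_ w)[|S CS wS]] := colN u uB; first by rewrite !inE wA.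
  have := hit1 _ (nbrs_clique_extend uA CS) => /eqP/cards1P[z Sz].
  have: u \in [set z] by rewrite -Sz in_setI uB setU11.
  have: w \in [set z] by rewrite -Sz in_setI wB in_setU wS orbT.
  by move=> /set1P wz /set1P uz; move: uw; rewrite uz wz adj_irr.
have vB : v \in B by rewrite !inE vA adj_irr.
(* As [B] is independent, the neighbours of [u] lie in [N]. Were [w] not among them, [u] would lose
   the s-cliques of [N] through [w] and have smaller degree than [v]. *)
have joinB u w : u \in B -> w \in N -> adj u w.
  move=> uB wN; apply: contraT => uw.
  have uA := subsetP BA u uB.
  have NuN : A :&: nbrs u \subset N.
    apply/subsetP => x; rewrite in_setI inE => /andP[xA ux].
    rewrite in_setI xA; apply: contraT => xv.
    by move: (indepB u x uB); rewrite ux inE xv xA; apply.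
  have: cliques s (A :&: nbrs u) \proper cliques s N.
    apply/properP; split.
      apply/subsetP => S /cliquesP[SA cS clS]; apply/cliquesP; split=> //.
      exact: subset_trans NuN.
    have [_ /(_ w wN)[S CS wS]] := colN v vB; exists S => //.
    apply: contra uw => /cliquesP[/subsetP SA _ _].
    by move: (SA w wS); rewrite !inE => /andP[].
  by move/proper_card; rewrite -!clique_degE // (degB u uB) ltnn.
have NB x : x \in A -> (x \in B) = (x \notin N) by rewrite !inE => ->; rewrite andbT.
split.
  have [[c cs cN] _] := colN v vB.
  (* Colours on [N] are below s, so s is fresh for [B]. *)
  exists (fun x => if x \in N then c x else s) => [x xA|x y xA yA].
    by case: ifP => // xN; apply: leqW; apply: cs.
  case: ifPn => xN; case: ifPn => yN; rewrite -?NB // in xN yN *.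
  - exact: cN.
  - by rewrite adj_sym joinB // neq_ltn cs.
  - by rewrite joinB // eq_sym neq_ltn cs.
  by rewrite eqxx; apply/negbTE/indepB.
move=> x xA; have [xB|] := boolP (x \in B).
  move: degv0; rewrite -(degB x xB) => /card_gt0P[S].
  by rewrite inE => /andP[CS xS]; exists S.
rewrite NB // negbK => xN; have [_ /(_ x xN)[S CS xS]] := colN v vB.
by exists (v |: S); [apply: nbrs_clique_extend | rewrite inE xS orbT].
Qed.
End Zykov.

(** * Intersecting families without a common t-subset *)

Lemma bin_leq_exp n k : 'C(n, k) <= n ^ k.
Proof.
apply: (@leq_trans (n ^_ k)); first by rewrite -bin_ffact leq_pmulr // fact_gt0.
by elim: k => // k IH; rewrite ffactnSr expnSr leq_mul // leq_subr.
Qed.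

Lemma card_supersets (T : finType) (U : {set T}) r :
  #|[set S : {set T} | U \subset S & #|S| == r]| <= #|T| ^ (r - #|U|).
Proof.
apply: leq_trans (bin_leq_exp _ _); rewrite -card_draws.
rewrite -(card_in_imset (f := fun S => S :\: U)); last first.
  move=> S S'; rewrite !inE => /andP[US _] /andP[US' _] e.
  by rewrite -(setID S U) -(setID S' U) e (setIidPr US) (setIidPr US').
apply/subset_leq_card/subsetP => _ /imsetP[S + ->].
by rewrite !inE => /andP[US /eqP <-]; rewrite cardsDS.
Qed.

Lemma card_bigcup_leq (I T : finType) (P : pred I) (F : I -> {set T}) k m :
  #|P| <= m -> (forall i, P i -> #|F i| <= k) -> #|\bigcup_(i | P i) F i| <= m * k.
Proof.
move=> Pm Fk; apply: (@leq_trans (\sum_(i | P i) #|F i|)).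
  elim/big_rec2: _ => [|i x y _ IH]; first by rewrite cards0.
  by rewrite (leq_trans (leq_of_leqif (leq_card_setU _ _))) ?leq_add2l.
apply: (@leq_trans (\sum_(i in P) k)); first exact: leq_sum.
by rewrite sum_nat_const leq_mul2r Pm orbT.
Qed.

(** In the bound, [2 ^ r] covers the t-subsets U of a fixed member, [r] the points outside U of a
    member not containing U, and the power of |T| the r-sets containing the resulting t + 1
    points. *)
Lemma intersecting_family (T : finType) (F : {set {set T}}) r t :
  t < r -> {in F, forall S : {set T}, #|S| = r} ->
  {in F &, forall S S' : {set T}, t <= #|S :&: S'|} ->
  (exists2 U : {set T}, #|U| = t & {in F, forall S : {set T}, U \subset S}) \/
  #|F| <= 2 ^ r * (r * #|T| ^ (r - t).-1).
Proof.
move=> tr Fr Ft.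
have [/existsP[U /andP[/eqP Ut /forall_inP UF]]|nU] :=
  boolP [exists U : {set T}, (#|U| == t) && [forall S in F, U \subset S]].
  by left; exists U.
right; have [->|[S1 FS1]] := set_0Vmem F; first by rewrite cards0.
have ex (U : {set T}) :
    exists S : {set T}, (#|U| == t) ==> (S \in F) && ~~ (U \subset S).
  have := existsPn nU U.
  (* The dummy [set0] for other sizes makes the choice function [w] total. *)
  case: (#|U| == t) => /= [|_]; last by exists set0.
  by case/forall_inPn => S FS US; exists S; rewrite FS.
pose w U := xchoose (ex U).
have wP (U : {set T}) : #|U| = t -> w U \in F /\ ~~ (U \subset w U).
  by move=> Ut; apply/andP/(implyP (xchooseP (ex U))); rewrite Ut.
pose up (U : {set T}) := [set S : {set T} | U \subset S & #|S| == r].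
have sub : F \subset \bigcup_(U | (U \in powerset S1) && (#|U| == t))
                       \bigcup_(x in w U :\: U) up (x |: U).
  apply/subsetP => S FS.
  have [U US Ut] : exists2 U : {set T}, U \subset S :&: S1 & #|U| = t.
    have := Ft S S1 FS FS1; rewrite -bin_gt0 -cards_draws => /card_gt0P[U].
    by rewrite inE => /andP[? /eqP]; exists U.
  have [US' US1] := subsetIP US; have [Fw Uw] := wP U Ut.
  apply/bigcupP; exists U; first by rewrite powersetE US1 Ut eqxx.
  (* Since [U] has t points and is not inside [w U], fewer than t of the at least t points of
     [S :&: w U] lie in [U]. *)
  have [x]: exists x, x \in (S :&: w U) :\: U.
    apply/card_gt0P; rewrite cardsD subn_gt0.
    apply: leq_trans (Ft S (w U) FS Fw); rewrite -Ut.
    apply: proper_card; apply/properP; split; first exact: subsetIr.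
    by have /subsetPn[y yU yw] := Uw; exists y => //; rewrite !inE (negPf yw) andbF.
  rewrite !inE => /and3P[xU xS xw]; apply/bigcupP; exists x; first by rewrite !inE xU.
  by rewrite inE subUset sub1set xS US' Fr /=.
apply: leq_trans (subset_leq_card sub) _; apply: card_bigcup_leq => [|U].
  rewrite -(Fr S1 FS1) -card_powerset; apply/subset_leq_card/subsetP => U.
  by case/andP.
move=> /andP[_ /eqP Ut]; have [Fw _] := wP U Ut; apply: card_bigcup_leq => [|x].
  by rewrite -(Fr _ Fw); apply/subset_leq_card/subsetDl.
rewrite inE => /andP[xU _]; apply: leq_trans (card_supersets _ _) _.
by rewrite cardsU1 xU Ut addnC addn1 subnS.
Qed.

(** All parts have size at least q, so the count is at least q^s. From 2t <= n and n - t < s q + s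
    <= 2 s q follows n <= 4 s q, whence C n^(s-1) <= D q^(s-1); the other summand of the threshold
    gives D < q. *)
Lemma turan_count_large C s n t :
  0 < s -> t.*2 + s * (C * (4 * s) ^ s.-1).+1 <= n ->
  C * n ^ s.-1 < turan_count (n - t) s.
Proof.
move=> s0 nt; set D := C * _ in nt; set q := (n - t) %/ s.
have Dq : D < q by rewrite /q leq_divRL //; lia.
have nq : n <= 4 * s * q.
  have := divn_eq (n - t) s; have := ltn_pmod (n - t) s0; rewrite -/q.
  have : s <= s * q by rewrite leq_pmulr //; lia.
  by lia.
apply: (@leq_trans (q ^ s)); last first.
  by rewrite -[in leqLHS](card_ord s) -prod_nat_const leq_prod // => i _; apply: leq_addr.
have s4 : 0 < (4 * s) ^ s.-1 by rewrite expn_gt0 muln_gt0 s0.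
have le1 : n ^ s.-1 <= (4 * s) ^ s.-1 * q ^ s.-1.
  by rewrite -expnMn; case: s.-1 => // k; rewrite leq_exp2r.
have le2 : C * n ^ s.-1 <= D * q ^ s.-1 by rewrite -mulnA leq_mul2l le1 orbT.
apply: leq_ltn_trans le2 _; rewrite -[X in _ < _ ^ X](prednK s0) expnS.
by rewrite ltn_pmul2r // expn_gt0; apply/orP; left; lia.
Qed.

(** * Cliques through a common t-clique and recognition of S(n, r, t) *)

Lemma card_cliques_common (G : sgraph) r t (U : {set G}) :
  #|U| = t -> {in cliques r [set: G], forall S : {set G}, U \subset S} ->
  #|cliques r [set: G]| <= #|cliques (r - t) [set x in ~: U | U \subset nbrs x]|.
Proof.
move=> Ut US.
rewrite -(card_in_imset (f := fun S => S :\: U)); last first.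
  move=> S S' /US US1 /US US2 e.
  by rewrite -(setID S U) -(setID S' U) e (setIidPr US1) (setIidPr US2).
apply/subset_leq_card/subsetP => _ /imsetP[S CS ->].
have {}US := US S CS; case/cliquesP: CS => _ cS clS; apply/cliquesP; split.
- apply/subsetP => x; rewrite !inE => /andP[xU xS]; rewrite xU.
  apply/subsetP => y yU; rewrite inE; apply: (cliqueP _ clS) => //; first exact: (subsetP US).
  by apply: contraNneq xU => ->.
- by rewrite cardsDS // cS Ut.
by apply: clique_sub clS; apply: subsetDl.
Qed.

(* An (r-t+1)-clique in the common neighbourhood of U, extended by all but one
   vertex of U, is an r-clique not containing U; this is where t > 0 is used. *)
Lemma common_nbrs_clique_free (G : sgraph) r t (U : {set G}) :
  0 < t < r -> #|U| = t -> clique U ->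
  {in cliques r [set: G], forall S : {set G}, U \subset S} ->
  cliques (r - t).+1 [set x in ~: U | U \subset nbrs x] = set0.
Proof.
move=> /andP[t0 tr] Ut clU US; apply/setP => Q; rewrite in_set0; apply/negP.
case/cliquesP => /subsetP QN cQ clQ.
have [x xU] : exists x, x \in U by apply/card_gt0P; rewrite Ut.
have dis : (U :\ x) :&: Q = set0.
  apply/setP => y; rewrite !inE; apply/negP => /andP[/andP[_ yU] /QN].
  by rewrite !inE yU.
have : U \subset (U :\ x) :|: Q.
  apply: US; apply/cliquesP; split; first exact: subsetT.
    rewrite cardsU dis cards0 cQ; move: Ut; rewrite (cardsD1 x) xU.
    by move: (#|U :\ x|) => k; lia.
  apply: cliqueU => //; first by apply: clique_sub clU; apply: subD1set.
  move=> y z; rewrite inE => /andP[_ yU] /QN; rewrite inE => /andP[_ /subsetP/(_ y yU)].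
  by rewrite inE adj_sym.
move/subsetP/(_ x xU); rewrite !inE eqxx /= => /QN.
by rewrite !inE xU.
Qed.

(** Each vertex of [U] becomes a singleton part. The classes of [c] have the Turan sizes only up to
    order, so the permutation [f] relabels them to match [turan_part]. *)
Lemma graph_iso_Sgraph (G : sgraph) n r t (U : {set G}) (c : G -> nat) :
  0 < t < r -> #|U| = t -> clique U -> {in ~: U, forall x, U \subset nbrs x} ->
  {in ~: U, forall x, c x < r - t} ->
  {in ~: U &, forall x y, adj x y = (c x != c y)} ->
  \sum_(i < r - t) #|[set x in ~: U | c x == i]| = n - t ->
  balanced (fun i : 'I_(r - t) => #|[set x in ~: U | c x == i]|) ->
  graph_iso G (Sgraph n r t).
Proof.
move=> /andP[t0 tr] Ut clU UN cs cE sum_c bal.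
have rt : 0 < r - t by rewrite subn_gt0.
have [|f bijf fE] := balanced_bij bal (@turan_part_balanced (n - t) (r - t)).
  by rewrite sum_turan_part.
have injf := bij_inj bijf.
(* The [insubd] defaults can occur only outside [U] for [e] and inside [U] for [c'], where [col]
   does not use them. *)
pose e (x : G) : 'I_t := insubd (Ordinal t0) (index x (enum U)).
pose c' (x : G) : 'I_(r - t) := insubd (Ordinal rt) (c x).
have e_inj : {in U &, injective e}.
  have lt_t x : x \in U -> index x (enum U) < t by rewrite -Ut cardE index_mem mem_enum.
  move=> x y xU yU /(congr1 val); rewrite !val_insubd !lt_t //.
  by apply: index_inj => //; rewrite mem_enum.
have cc' x : x \notin U -> c' x = c x :> nat.
  by move=> xU; rewrite val_insubd cs // inE.
pose col x : 'I_t + 'I_(r - t) := if x \in U then inl (e x) else inr (f (c' x)).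
apply: (graph_iso_coloring (c := col) (d := Sgraph_color rt)).
- move=> x y; rewrite /col; case: ifPn => xU; case: ifPn => yU.
  + have [->|xy] := eqVneq x y; first by rewrite adj_irr eqxx.
    rewrite (cliqueP _ clU) //; symmetry; apply: contraNneq xy => -[exy].
    exact/eqP/e_inj.
  + by rewrite adj_sym; have /UN/subsetP/(_ x xU) : y \in ~: U; rewrite inE.
  + by have /UN/subsetP/(_ y yU) : x \in ~: U; rewrite inE.
  rewrite cE ?inE // -cc' // -(cc' y) //.
  by rewrite (inj_eq inr_inj) (inj_eq injf) -val_eqE.
- exact: Sgraph_colorE.
move=> i; rewrite card_Sgraph_color; case: i => i.
  have /imsetP[x xU ->] : i \in e @: U.
    have /eqP-> : e @: U == setT.
      by rewrite eqEcard subsetT cardsT card_ord card_in_imset // Ut /=.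
    by rewrite inE.
  rewrite -(cards1 x); apply: eq_card => y; rewrite !inE /col.
  case: ifPn => yU; last by symmetry; apply: contraNF yU => /eqP->.
  by apply/eqP/eqP => [[/e_inj->]|->].
have [g fK gK] := bijf; rewrite -(gK i) fE; apply: eq_card => x; rewrite !inE /col.
case: ifPn => xU //=.
by rewrite (inj_eq inr_inj) (inj_eq injf) -cc'.
Qed.

(** * Extremality and uniqueness of S(n, r, t) for large n *)

Theorem theorem1p3 (r t : nat) (ht : 1 <= t) (hr : t < r) :
  exists n0 : nat,
    forall (n : nat) (G : sgraph),
      n0 <= n -> #|G| = n -> intersecting r t G ->
      Ncopies r G <= Ncopies r (Sgraph n r t)
      /\ (Ncopies r G = Ncopies r (Sgraph n r t) <-> graph_iso G (Sgraph n r t)).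
Proof.
have rt : 0 < r - t by rewrite subn_gt0.
(* The threshold of [turan_count_large] for s = r - t and C = 2^r r, the constant from
   [intersecting_family]. *)
exists (t.*2 + (r - t) * (2 ^ r * r * (4 * (r - t)) ^ (r - t).-1).+1) => n G nlarge Gn Gint.
have large := turan_count_large rt nlarge.
set K := cliques r [set: G].
suff [le eq_iso] : #|K| <= turan_count (n - t) (r - t) /\
    (#|K| = turan_count (n - t) (r - t) -> graph_iso G (Sgraph n r t)).
  split; first by rewrite Ncopies_Sgraph // Ncopies_cliques.
  by split=> [|/Ncopies_iso //]; rewrite Ncopies_Sgraph // Ncopies_cliques.
have Kr : {in K, forall S : {set G}, #|S| = r} by move=> S /cliquesP[].
have Kt : {in K &, forall S S' : {set G}, t <= #|S :&: S'|}.
  move=> S S' KS KS'; have [<-|SS'] := eqVneq S S'; first by rewrite setIid Kr // ltnW.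
  have copy Q : Q \in K -> is_copy r Q by case/cliquesP => _ cQ clQ; rewrite is_copyE cQ eqxx.
  by have /andP[] := Gint S S' (copy S KS) (copy S' KS') SS'.
(* A strict bound settles both claims, the equality case becoming vacuous. *)
have strict k : k < turan_count (n - t) (r - t) -> k <= turan_count (n - t) (r - t) /\
    (k = turan_count (n - t) (r - t) -> graph_iso G (Sgraph n r t)).
  by move=> lt; split=> [|e]; [apply: ltnW | move: lt; rewrite e ltnn].
have [[U Ut US]|small] := intersecting_family hr Kr Kt; last first.
  by apply/strict/(leq_ltn_trans _ large); rewrite -mulnA -Gn.
(* Only an actual r-clique containing [U] shows that [U] is a clique. *)
have [K0|[S0 KS0]] := set_0Vmem K.
  by apply/strict/(leq_ltn_trans _ large); rewrite K0 cards0.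
have clU : clique U by case/cliquesP: (KS0) => _ _; apply: clique_sub; apply: US.
have htr : 0 < t < r by rewrite ht.
set N := [set x in ~: U | U \subset nbrs x].
have NU : N \subset ~: U by apply/subsetP => x; rewrite inE => /andP[].
have cU : #|~: U| = n - t by rewrite -Gn -Ut -(cardsC U) addKn.
have cN : #|N| <= n - t by rewrite -cU subset_leq_card.
have le1 : #|K| <= #|cliques (r - t) N| := card_cliques_common Ut US.
have [le2 eq2] := zykov (common_nbrs_clique_free htr Ut clU US).
rewrite -/N in le2 eq2.
have le3 : turan_count #|N| (r - t) <= turan_count (n - t) (r - t).
  rewrite [leqLHS]/turan_count; apply: prod_le_turan_count => //.
  by rewrite sum_turan_part.
split=> [|eqK]; first exact: leq_trans (leq_trans le1 le2) le3.
(* The chain [le1], [le2], [le3] collapses to equalities, with a positive value by [large]. *)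
have [||[c cs cE] _] := eq2; [lia|lia|].
pose a (i : 'I_(r - t)) := #|[set x in N | c x == i]|.
have sum_a : \sum_i a i = #|N|.
  pose c' (x : G) : 'I_(r - t) := insubd (Ordinal rt) (c x).
  rewrite -sum1_card (partition_big c' predT) //=; apply: eq_bigr => i _.
  rewrite /a -[LHS]sum1_card; apply: eq_bigl => x; rewrite inE.
  by case: (boolP (x \in N)) => //= xN; rewrite -val_eqE val_insubd cs.
have prod_a : #|cliques (r - t) N| = \prod_i a i.
  pose c' (x : G) : 'I_(r - t) := insubd (Ordinal rt) (c x).
  have c'E x : x \in N -> c' x = c x :> nat by move=> xN; rewrite val_insubd cs.
  rewrite -[X in cliques X _](card_ord (r - t)) (card_multipartite_cliques (c := c')).
    apply: eq_bigr => i _; apply: eq_card => x; rewrite inE [RHS]inE.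
    by case: (boolP (x \in N)) => //= xN; rewrite -c'E.
  by move=> x y xN yN; rewrite cE // -!c'E.
(* The class sizes attain the maximal product for total [n - t]; hence they are balanced and exhaust
   the complement of [U]. *)
have [||||eqN bal_a] := @prod_eq_turan_count (n - t) _ a; [done|lia|lia|lia|].
have NE : N = ~: U.
  by apply/eqP; rewrite eqEcard NU cU -eqN sum_a leqnn.
apply: (graph_iso_Sgraph (c := c) htr Ut clU); rewrite -?NE //.
by move=> x; rewrite inE => /andP[].
Qed.
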